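(* Let $n=2$, $d\ge 225\log 6$, $\sigma_1^2=3$, $\sigma_2^2=1$, and let $\bar\Theta_\kappa=\{\boldsymbol\theta\in(\mathbb R^d)^2:\ \bar\kappa(\boldsymbol\theta,\boldsymbol\sigma)\ge\kappa\}$. If $\kappa<0.1(2d)^{1/2}$, then $$\sup_{\boldsymbol\theta\in\bar\Theta_\kappa}\mathbf P_{\boldsymbol\theta,\boldsymbol\sigma,id}(\pi^{\mathrm{gr}}\ne id)\ge\frac12,$$ where $id$ is the identity permutation.
   Context: Model: integers $n\ge2$, $d\ge1$. Unknown parameters: $\boldsymbol\theta=(\theta_1,\dots,\theta_n)$ with $\theta_i\in\mathbb R^d$, noise levels $\boldsymbol\sigma=(\sigma_1,\dots,\sigma_n)$ with $\sigma_i>0$, and a permutation $\pi^*\in\mathfrak S_n$. One observes $X_i=\theta_i+\sigma_i\xi_i$, $X_i^\#=\theta_{\pi^*(i)}+\sigma_i^\#\xi_i^\#$, $i=1,\dots,n$, where $\sigma_i^\#=\sigma_{\pi^*(i)}$ and $\xi_1,\dots,\xi_n,\xi_1^\#,\dots,\xi_n^\#$ are i.i.d. $\mathcal N(0,I_d)$. The law of the data is $\mathbf P_{\boldsymbol\theta,\boldsymbol\sigma,\pi^*}$. Greedy estimator: $\pi^{\mathrm{gr}}(1)=\arg\min_{j\in\{1,\dots,n\}}\|X_j-X_1^\#\|$ and recursively, for $i\ge2$, $\pi^{\mathrm{gr}}(i)=\arg\min_{j\notin\{\pi^{\mathrm{gr}}(1),\dots,\pi^{\mathrm{gr}}(i-1)\}}\|X_j-X_i^\#\|$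 (ties broken arbitrarily). Relative separation distance: $\bar\kappa(\boldsymbol\theta,\boldsymbol\sigma)=\min_{i\ne j}\frac{\|\theta_i-\theta_j\|}{(\sigma_i^2+\sigma_j^2)^{1/2}}$. *)

(* Defs.v *)
From HB Require Import structures.
From mathcomp Require Import all_boot all_order all_algebra.
From mathcomp Require Import fingroup perm.
From mathcomp Require Import all_classical all_reals all_analysis.
From mathcomp Require Import normal_distribution.

Set Implicit Arguments.
Unset Strict Implicit.
Unset Printing Implicit Defensive.

Import Order.TTheory GRing.Theory Num.Theory.
Local Open Scope classical_set_scope.
Local Open Scope ring_scope.

Section permutation_model.
Context {R : realType}.

Definition enorm (d : nat) (v : 'rV[R]_d) : R :=
  Num.sqrt (\sum_(k < d) v 0 k ^+ 2).

Definition kappa_bar (n d : nat) (theta : 'I_n -> 'rV[R]_d) (sigma : 'I_n -> R)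
  : \bar R :=
  \big[Order.min/+oo%E]_(ij : 'I_n * 'I_n | ij.1 != ij.2)
     (enorm (theta ij.1 - theta ij.2) /
        Num.sqrt (sigma ij.1 ^+ 2 + sigma ij.2 ^+ 2))%:E.

(* The noise: xi (false, i, k) is the k-th coordinate of xi_i,
   xi (true, i, k) is the k-th coordinate of xi_i^#. *)
Definition noise_vec (n d : nat) (T : Type) (xi : bool * 'I_n * 'I_d -> T -> R)
  (b : bool) (i : 'I_n) (w : T) : 'rV[R]_d :=
  \row_(k < d) xi (b, i, k) w.

Definition obsX (n d : nat) (T : Type) (theta : 'I_n -> 'rV[R]_d)
  (sigma : 'I_n -> R) (xi : bool * 'I_n * 'I_d -> T -> R) (w : T) (i : 'I_n)
  : 'rV[R]_d :=
  theta i + sigma i *: noise_vec xi false i w.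

Definition obsXs (n d : nat) (T : Type) (theta : 'I_n -> 'rV[R]_d)
  (sigma : 'I_n -> R) (pi : {perm 'I_n}) (xi : bool * 'I_n * 'I_d -> T -> R)
  (w : T) (i : 'I_n) : 'rV[R]_d :=
  theta (pi i) + sigma (pi i) *: noise_vec xi true i w.

(* p is a possible output of the greedy estimator (for some tie-breaking
   rule): for each i, p(i) minimises |X_j - X_i^#| over the j not already
   chosen at steps i' < i. *)
Definition greedy_output (n d : nat) (X Xs : 'I_n -> 'rV[R]_d)
  (p : {perm 'I_n}) : Prop :=
  forall i j : 'I_n,
    (forall i' : 'I_n, (i' < i)%N -> p i' != j) ->
    enorm (X (p i) - Xs i) <= enorm (X j - Xs i).

(* Event {pi^gr <> id}, with ties broken in the worst way: the identity is
   not an admissible greedy output. *)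
Definition greedy_error (n d : nat) (T : Type) (theta : 'I_n -> 'rV[R]_d)
  (sigma : 'I_n -> R) (pi : {perm 'I_n}) (xi : bool * 'I_n * 'I_d -> T -> R)
  : set T :=
  [set w | ~ greedy_output (obsX theta sigma xi w) (obsXs theta sigma pi xi w) 1%g].

Definition iid_std_normal (dT : measure_display) (T : measurableType dT)
  (P : probability T R) (I : finType) (f : I -> T -> R) : Prop :=
  [/\ (forall c, measurable_fun setT (f c)),
      (forall c (A : set R), measurable A ->
          P (f c @^-1` A) = normal_prob 0 1 A) &
      (forall A : I -> set R, (forall c, measurable (A c)) ->
          P (\bigcap_(c in setT) (f c @^-1` A c)) =
          (\prod_(c : I) P (f c @^-1` A c))%E)].

End permutation_model.

(* Main.v *)
(** Take theta_1 = 0 and theta_2 = delta (1, ..., 1) with delta^2 = 2/25, for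
which the relative separation equals sqrt(2 d) / 10.  The greedy estimator
errs exactly when X_2 is strictly closer to X_1^# than X_1 is, that is, when
D = |X_1 - X_1^#|^2 - |X_2 - X_1^#|^2 > 0.  Because sigma_1^2 = 3 exceeds
sigma_2^2 = 1, D has mean 2 d - delta^2 d = (48/25) d although theta_1 is the
correct centre, and its fluctuation is a combination of six sums over the
coordinates of products of Hermite polynomials in the noise.  Products of
independent centred factors are orthogonal, so each sum has second moment
O(d), and Chebyshev's inequality gives P(D <= 0) <= 1/2 as soon as d >= 300;
this follows from d >= 225 ln 6 since ln 6 >= 4/3. *)

Require Import Defs.
From HB Require Import structures.
From mathcomp Require Import all_boot all_order all_algebra.
From mathcomp Require Import fingroup perm.
From mathcomp Require Import all_classical all_reals all_analysis.
From mathcomp Require Import normal_distribution.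
From mathcomp Require Import measurable_realfun ring lra.

Import Order.TTheory GRing.Theory Num.Theory.
Local Open Scope classical_set_scope.
Local Open Scope ring_scope.

(** * Moments of the standard normal law *)

Section weighted_image.
Context {d d'} {T : measurableType d} {T' : measurableType d'} {R : realType}.
Variables (mu : {measure set T -> \bar R}) (nu : {measure set T' -> \bar R}).
Variables (X : T -> T') (w : T -> R).
Hypotheses (mX : measurable_fun setT X) (mw : measurable_fun setT w).
Hypothesis w_ge0 : forall x, 0 <= w x.
Hypothesis nuE : forall A, measurable A ->
  nu A = (\int[mu]_x (\1_A (X x) * w x)%:E)%E.

Import HBNNSimple.

(** Both sides agree on indicators by [nuE], hence on simple functions by linearity and on
    nonnegative functions by monotone convergence. Its instances below are densities ([X = id]),
    laws and reflections ([w = 1]), and independence ([w] the product of the other factors). *)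
Lemma ge0_integral_weighted_image (f : T' -> \bar R) :
  measurable_fun setT f -> (forall y, 0 <= f y)%E ->
  (\int[nu]_y f y = \int[mu]_x (f (X x) * (w x)%:E))%E.
Proof.
move=> mf f0; pose h := nnsfun_approx measurableT mf.
have fE y : f y = limn (fun n => (h n y)%:E).
  by apply/esym/cvg_lim => //; exact: cvg_nnsfun_approx.
transitivity (limn (fun n => \int[nu]_y (h n y)%:E))%E.
  rewrite -monotone_convergence//; first exact: eq_integral.
  - by move=> n; exact/measurable_EFinP.
  - by move=> n y _; rewrite lee_fin.
  - by move=> y _ m n mn; rewrite lee_fin; exact/lefP/nd_nnsfun_approx.
transitivity (limn (fun n => \int[mu]_x (h n (X x) * w x)%:E))%E; last first.
  rewrite -monotone_convergence//.
  - apply: eq_integral => x _; apply/cvg_lim => //=.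
    under eq_fun do rewrite EFinM.
    by apply: cvgeZr => //; exact: cvg_nnsfun_approx.
  - move=> n; apply/measurable_EFinP/measurable_funM => //.
    exact: measurableT_comp.
  - by move=> n y _; rewrite lee_fin mulr_ge0.
  - move=> y _ m n mn; rewrite lee_fin ler_wpM2r//.
    exact/lefP/nd_nnsfun_approx.
apply: congr_lim; apply/funext => n.
rewrite integralT_nnsfun sintegralE.
under [RHS]eq_integral => x _.
  rewrite (fimfunE (h n)) mulrC EFinM -fsumEFin// ge0_mule_fsumr; last first.
    by move=> r; rewrite EFinM nnfun_muleindic_ge0.
  over.
rewrite [RHS]ge0_integral_fsum//; last 2 first.
- move=> r; apply/measurable_EFinP/measurable_funM => //.
  apply: measurable_funM => //; apply: measurableT_comp => //.
- by move=> r x _; rewrite mule_ge0 ?lee_fin// -lee_fin EFinM nnfun_muleindic_ge0.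
apply: eq_fsbigr => r _; rewrite nuE//.
(* The scalar [r] can leave the integral only when it is nonnegative; a negative value is never
   taken by [h n], and both sides then vanish. *)
have [r0|r0] := leP 0 r; last first.
  rewrite preimage_nnfun0//.
  under eq_integral do rewrite indicE in_set0 mul0r.
  under [RHS]eq_integral do rewrite indicE in_set0 mulr0 mule0.
  by rewrite !integral0 mule0.
rewrite -ge0_integralZl//.
- by apply: eq_integral => x _; rewrite -!EFinM [in LHS]mulrA [in LHS]mulrC.
- apply/measurable_EFinP/measurable_funM => //.
  by apply: measurableT_comp => //.
- by move=> x _; rewrite lee_fin mulr_ge0.
Qed.

End weighted_image.

Section integrable_EFin.
Context {d} {T : measurableType d} {R : realType}.
Variable mu : {measure set T -> \bar R}.

Lemma integrable_EFinZl (k : R) (f : T -> R) :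
  mu.-integrable setT (EFin \o f) ->
  mu.-integrable setT (EFin \o (fun x => k * f x)).
Proof. by move=> /(integrableZl measurableT k); exact: eq_integrable. Qed.

Lemma integrable_EFinD (f g : T -> R) :
  mu.-integrable setT (EFin \o f) -> mu.-integrable setT (EFin \o g) ->
  mu.-integrable setT (EFin \o (fun x => f x + g x)).
Proof. by move=> fi /(integrableD measurableT fi); exact: eq_integrable. Qed.

End integrable_EFin.

Section normal_moments.
Context {R : realType}.
Local Notation mu := (@lebesgue_measure R).
Local Notation N := (normal_prob (0 : R) 1).

Lemma ge0_integral_normal_prob (m s : R) (f : R -> \bar R) :
  measurable_fun setT f -> (forall x, 0 <= f x)%E ->
  (\int[normal_prob m s]_x f x = \int[mu]_x (f x * (normal_pdf m s x)%:E))%E.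
Proof.
move=> mf f0.
apply: (@ge0_integral_weighted_image _ _ _ _ _ mu (normal_prob m s) id) => //.
- exact: measurable_normal_pdf.
- by move=> x; exact: normal_pdf_ge0.
- move=> A mA; rewrite [LHS]integral_mkcond epatch_indic.
  by apply: eq_integral => x _; rewrite /= mulrC.
Qed.

(* The integrand times the N(0,1) density is s times the N(0,s^2) density. *)
Lemma integral_normal_expR_sqr (s : R) : 0 < s ->
  (\int[N]_x (expR ((1 - s ^- 2) / 2 * x ^+ 2))%:E = s%:E)%E.
Proof.
move=> s0; rewrite ge0_integral_normal_prob; first last.
- by move=> x; rewrite lee_fin expR_ge0.
- apply/measurable_EFinP; apply: measurableT_comp => //.
  by apply: measurable_funM => //; exact: measurable_funX.
transitivity (\int[mu]_x (s%:E * (normal_pdf 0 s x)%:E))%E.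
  apply: eq_integral => x _; rewrite -!EFinM; congr EFin.
  have peakE : normal_peak 1 = s * normal_peak s.
    rewrite /normal_peak expr1n mul1r -[in RHS]mulrnAr sqrtrM ?sqr_ge0//.
    by rewrite sqrtr_sqr gtr0_norm// invfM mulVKf// gt_eqF.
  rewrite !normal_pdfE ?oner_eq0 ?gt_eqF// peakE /normal_fun mulrCA -expRD.
  rewrite [RHS]mulrA; congr (_ * expR _); rewrite !subr0; field.
  by rewrite gt_eqF.
rewrite ge0_integralZl//.
- by rewrite integral_normal_pdf mule1.
- by apply/measurable_EFinP; exact: measurable_normal_pdf.
- by move=> x _; rewrite lee_fin normal_pdf_ge0.
- by rewrite lee_fin ltW.
Qed.

Lemma integrable_normal_expR_sqr (s : R) : 0 < s ->
  N.-integrable setT (EFin \o (fun x => expR ((1 - s ^- 2) / 2 * x ^+ 2))).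
Proof.
move=> s0; apply/integrableP; split.
  apply/measurable_EFinP; apply: measurableT_comp => //.
  by apply: measurable_funM => //; exact: measurable_funX.
under eq_integral do rewrite /= ger0_norm ?expR_ge0//.
by rewrite integral_normal_expR_sqr// ltry.
Qed.

Lemma integrable_normal_exprn k : (k <= 4)%N ->
  N.-integrable setT (EFin \o (fun x => x ^+ k)).
Proof.
move=> k4.
(* At s = 2 the exponent is t = 3 x^2 / 8, and exp t >= 1 + t^2 / 2 = 1 + 9 x^4 / 128. Since 16 * 9
   / 128 >= 1, the function 16 exp t dominates x^4, and it dominates 1 as well. *)
have /(integrableZl measurableT 16) := integrable_normal_expR_sqr 2 (ltr0Sn R 1).
apply: le_integrable => //.
  by apply/measurable_EFinP; exact: measurable_funX.
move=> x _; rewrite /= lee_fin normrX.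
rewrite [leRHS]ger0_norm ?mulr_ge0 ?expR_ge0//.
set t := _ * _ ^+ 2; have t0 : 0 <= t.
  by rewrite mulr_ge0 ?sqr_ge0//; lra.
have := expR_ge1Dxn 1 t0; rewrite {1}/t exprMn -exprM/= => h.
have [x1|x1] := leP `|x| 1.
  have := expR_ge1Dx t.
  have : `|x| ^+ k <= 1 by rewrite exprn_ile1.
  lra.
have : `|x| ^+ k <= x ^+ 4.
  by rewrite -[x ^+ 4]ger0_norm ?exprn_even_ge0// normrX ler_weXn2l// ltW.
have : 0 <= x ^+ 4 by rewrite exprn_even_ge0.
move: h; rewrite (_ : (2`!)%:R = 2) //.
have := expR_ge0 t.
lra.
Qed.

Lemma Rintegral_normal_cst (r : R) : \int[N]_x r = r.
Proof.
rewrite Rintegral_cst// [X in fine X](_ : _ = 1%E) ?mulr1//.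
exact: integral_normal_pdf.
Qed.

(** Expectation of 1 + y <= exp y at y = (1 - s^-2) x^2 / 2. Having this for every s > 0 determines
    the second moment without integration by parts. *)
Lemma normal_sqr_mgf_ge (s : R) : 0 < s ->
  1 + (1 - s ^- 2) / 2 * \int[N]_x (x ^+ 2) <= s.
Proof.
move=> s0; have i2 := @integrable_normal_exprn 2 isT.
have ie := integrable_normal_expR_sqr s s0.
rewrite -[leRHS]/(fine s%:E) -(integral_normal_expR_sqr s s0).
rewrite -RintegralZl//.
rewrite -[X in X + _]Rintegral_normal_cst -RintegralD//; last 2 first.
- exact: finite_measure_integrable_cst.
- exact: integrable_EFinZl.
apply: le_Rintegral => //.
- apply: integrable_EFinD => //; first exact: finite_measure_integrable_cst.
  exact: integrable_EFinZl.
- by move=> x _; exact: expR_ge1Dx.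
Qed.

(* The bound above at s = sqrt m, with m the second moment, reads
   (s - 1)^2 <= 0. *)
Lemma normal_moment2 : \int[N]_x (x ^+ 2) = 1.
Proof.
set m := Rintegral _ _ _.
(* At s = 1/2 the bound reads 1 - 3 m / 2 <= 1/2, so m >= 1/3. *)
have m0 : 0 < m.
  by have := @normal_sqr_mgf_ge 2^-1; rewrite -/m exprVn invrK; lra.
have sm0 : 0 < Num.sqrt m by rewrite sqrtr_gt0.
have := normal_sqr_mgf_ge _ sm0; rewrite -/m sqr_sqrtr ?(ltW m0)//.
have -> : (1 - m^-1) / 2 * m = (m - 1) / 2 by field; rewrite gt_eqF.
rewrite -[m in (m - 1)]sqr_sqrtr ?(ltW m0)// => h.
have : (Num.sqrt m - 1) ^+ 2 <= 0 by rewrite sqrrB; lra.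
rewrite le_eqVlt ltNge sqr_ge0 orbF expf_eq0/= subr_eq0 => /eqP s1.
by rewrite -[m]sqr_sqrtr ?(ltW m0)// s1 expr1n.
Qed.

(* From exp y >= (1 + y/4)^4 >= 1 + y + (3/8) y^2 at y = a x^2. *)
Lemma normal_moment4_le : \int[N]_x (x ^+ 4) <= 5.
Proof.
(* With second moment 1, the fourth moment is at most (s - 1 - a) / (3 a^2 / 8). This s gives a =
   21/242 and a value of about 4.68. *)
pose s : R := 11 / 10; have s0 : 0 < s by rewrite divr_gt0.
set a := (1 - s ^- 2) / 2.
have aE : a = 21 / 242 by rewrite /a /s; field.
have i2 := @integrable_normal_exprn 2 isT.
have i4 := @integrable_normal_exprn 4 isT.
have i24 : N.-integrable setT
    (EFin \o (fun x => a * x ^+ 2 + 3 / 8 * a ^+ 2 * x ^+ 4)).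
  by apply: integrable_EFinD; exact: integrable_EFinZl.
have i1 : N.-integrable setT (EFin \o (fun _ => 1)).
  exact: finite_measure_integrable_cst.
suff : \int[N]_x (1 + (a * x ^+ 2 + 3 / 8 * a ^+ 2 * x ^+ 4)) <= s.
  rewrite RintegralD// RintegralD//; [|exact: integrable_EFinZl..].
  rewrite !RintegralZl// normal_moment2 Rintegral_normal_cst aE /s; lra.
rewrite -[leRHS]/(fine s%:E) -(integral_normal_expR_sqr s s0) -/a.
apply: le_Rintegral => //.
- exact: integrable_EFinD.
- exact: integrable_normal_expR_sqr.
move=> x _; have a0 : 0 <= a * x ^+ 2 by rewrite mulr_ge0 ?sqr_ge0// aE; lra.
rewrite -mulrA -[x ^+ 4]/(x ^+ (2 * 2)) exprM -exprMn.
move: (a * x ^+ 2) a0 => y y0.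
have -> : expR y = expR (y / 4) ^+ 4.
  by rewrite -expRM_natl; congr expR; field.
apply: (@le_trans _ _ ((1 + y / 4) ^+ 4)).
  have : 0 <= y ^+ 3 by rewrite exprn_ge0.
  have : 0 <= y ^+ 4 by rewrite exprn_ge0.
  rewrite [(1 + _) ^+ 4](_ : _ =
    1 + y + 3 / 8 * y ^+ 2 + y ^+ 3 / 16 + y ^+ 4 / 256); last by field.
  lra.
by rewrite lerXn2r ?nnegrE ?expR_ge0 ?expR_ge1Dx// addr_ge0// divr_ge0.
Qed.

(** Reflection exchanges the positive and negative parts of the integrand, so their integrals
    coincide; integrability makes them finite, and the difference is 0. *)
Lemma normal_moment1 : \int[N]_x x = 0.
Proof.
have sym (f : R -> \bar R) : measurable_fun setT f -> (forall x, 0 <= f x)%E ->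
    (\int[N]_x f x = \int[N]_x f (- x)%R)%E.
  move=> mf f0; rewrite !ge0_integral_normal_prob//; last first.
    by apply: measurableT_comp => //; exact: oppr_measurable.
  (* Lebesgue measure is its own image under reflection, and the density is even. *)
  rewrite (@ge0_integral_weighted_image _ _ _ _ _ mu mu -%R (cst 1))//.
  - apply: eq_integral => x _; rewrite mule1; congr (_ * _%:E)%E.
    rewrite !normal_pdfE ?oner_eq0// /normal_fun.
    by congr (_ * expR _); rewrite !subr0 sqrrN.
  - move=> A mA; transitivity (mu (-%R @^-1` A)).
      exact/esym/lebesgue_measureN.
    under eq_integral do rewrite mulr1.
    rewrite -[RHS]/(\int[mu]_x (\1_(-%R @^-1` A) x)%:E)%E integral_indic ?setIT//.
    by rewrite -[_ @^-1` _]setTI; exact: oppr_measurable.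
  - apply: emeasurable_funM => //; apply/measurable_EFinP.
    exact: measurable_normal_pdf.
  - by move=> x; rewrite mule_ge0// lee_fin normal_pdf_ge0.
have i1 := integrable_normal_exprn 1 isT.
rewrite /Rintegral integralE.
rewrite [X in (X - _)%E]sym; last 2 first.
- exact: measurable_funepos.
- exact: funepos_ge0.
rewrite [X in (X - _)%E](_ : _ = \int[N]_x (EFin \o (fun x : R => x))^\- x)%E.
  rewrite subee//; exact: integrable_neg_fin_num i1.
by apply: eq_integral => x _; rewrite funeposE funenegE/= EFinN.
Qed.

End normal_moments.

(** * Expectations of products of independent variables *)

Section independent_products.
Context {d} {T : measurableType d} {R : realType}.
Variables (P : probability T R) (I : finType) (X : I -> T -> R).
Hypothesis mX : forall c, measurable_fun setT (X c).
Hypothesis indep : forall A : I -> set R, (forall c, measurable (A c)) ->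
  P (\bigcap_(c in setT) (X c @^-1` A c)) = (\prod_(c : I) P (X c @^-1` A c))%E.

Let update (f : I -> R -> R) a g := fun c => if c == a then g else f c.

(** [h] is abstract so that one statement splits both the product of values at a point and the
    product of integrals. *)
Let prod_update (f : I -> R -> R) a g (h : I -> (R -> R) -> R) :
  \prod_c h c (update f a g c) = h a g * \prod_(c | c != a) h c (f c).
Proof.
rewrite (bigD1 a)//= /update eqxx; congr (_ * _).
by apply: eq_bigr => c /negbTE ->.
Qed.

Let measurable_comp_X (f : R -> R) c : measurable_fun setT f ->
  measurable_fun setT (fun t => f (X c t)).
Proof. by move=> mf; exact: measurableT_comp (mX c). Qed.

Let measurable_preimage_X (A : set R) c : measurable A ->
  measurable (X c @^-1` A).
Proof. by move=> mA; rewrite -[_ @^-1` _]setTI; exact: mX. Qed.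

Let integral_prod_indic (A : I -> set R) : (forall c, measurable (A c)) ->
  (\int[P]_t (\prod_c \1_(A c) (X c t))%:E =
   (\prod_c \int[P]_t \1_(A c) (X c t))%:E)%E.
Proof.
move=> mA.
transitivity (\int[P]_t (\1_(\bigcap_(c in setT) (X c @^-1` A c)) t)%:E)%E.
  apply: eq_integral => t _; congr EFin.
  rewrite indicE; case: (boolP (t \in _)) => [|].
    rewrite inE => h; rewrite big1// => c _.
    by rewrite indicE mem_set//; exact: h.
  rewrite notin_setE => /existsNP[c /not_implyP[_ Xc]].
  by rewrite (bigD1 c)//= indicE memNset ?mul0r.
rewrite integral_indic ?setIT//; last first.
  by apply: fin_bigcap_measurable => // c _; exact: measurable_preimage_X.
apply: etrans (indep A mA) _; rewrite -prodEFin; apply: eq_bigr => c _.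
rewrite -[X in X%:E]/(fine (\int[P]_t (\1_(X c @^-1` A c) t)%:E)%E).
rewrite integral_indic ?setIT//; last exact: measurable_preimage_X.
by rewrite fineK// fin_num_measure//; exact: measurable_preimage_X.
Qed.

Lemma ge0_integral_prod_independent (f : I -> R -> R) :
  (forall c, measurable_fun setT (f c)) ->
  (forall c x, 0 <= f c x) ->
  (forall c, P.-integrable setT (EFin \o (fun t => f c (X c t)))) ->
  (\int[P]_t (\prod_c f c (X c t))%:E =
   (\prod_c \int[P]_t f c (X c t))%:E)%E.
Proof.
(* Starting from indicators, factors are replaced one at a time: for fixed
   other factors both sides are measures in the set defining the indicator. *)
suff gen (s : seq I) : (forall c, measurable_fun setT (f c)) ->
    (forall c x, 0 <= f c x) ->
    (forall c, P.-integrable setT (EFin \o (fun t => f c (X c t)))) ->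
    (forall c, c \notin s -> exists2 A, measurable A & f c = \1_A) ->
    (\int[P]_t (\prod_c f c (X c t))%:E =
     (\prod_c \int[P]_t f c (X c t))%:E)%E.
  by move=> mf f0 fi; apply: (gen (enum I)) => // c; rewrite mem_enum.
elim: s f => [|a s IH] f mf f0 fi fs.
  have /choice[A hA] c : exists A, measurable A /\ f c = \1_A.
    by have [A] := fs c isT; exists A.
  under eq_integral do under eq_bigr do rewrite (hA _).2.
  rewrite integral_prod_indic; last by move=> c; exact: (hA c).1.
  congr EFin; apply: eq_bigr => c _; apply: eq_Rintegral => t _.
  by rewrite (hA c).2.
pose w t := \prod_(c | c != a) f c (X c t).
pose K := \prod_(c | c != a) \int[P]_t f c (X c t).
have w0 t : 0 <= w t by exact: prodr_ge0.
have K0 : 0 <= K by apply: prodr_ge0 => c _; exact: Rintegral_ge0.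
have mw : measurable_fun setT w.
  rewrite /w; under eq_fun do rewrite -big_filter.
  by apply: measurable_prod => c _; exact: measurable_comp_X.
pose Xa : {mfun T >-> R} :=
  HB.pack (X a) (isMeasurableFun.Build _ _ _ _ (X a) (mX a)).
(* By [IH] with an indicator at [a], this multiple of the law of [X a] is the image under [X a] of
   the measure with density [w]. The change of variables then passes from indicators to [f a]. *)
pose nu := mscale (NngNum K0) (distribution P Xa).
have nuE A : measurable A ->
    nu A = (\int[P]_t (\1_A (X a t) * w t)%:E)%E.
  move=> mA; have := IH (update f a \1_A).
  under eq_integral do rewrite (prod_update f a _ (fun c g => g (X c _))).
  rewrite (prod_update f a _ (fun c g => \int[P]_t g (X c t))) => ->.
  - rewrite /nu /mscale/= EFinM muleC; congr (_ * _)%E.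
    rewrite /Rintegral -[X in fine X]/(\int[P]_t (\1_(X a @^-1` A) t)%:E)%E.
    rewrite integral_indic ?setIT//; last exact: measurable_preimage_X.
    by rewrite fineK// fin_num_measure//; exact: measurable_preimage_X.
  - by move=> c; rewrite /update; case: ifP.
  - by move=> c x; rewrite /update; case: ifP.
  - move=> c; rewrite /update; case: ifP => // _.
    apply: (@integrable_indic _ _ _ P (X c @^-1` A)).
    exact: measurable_preimage_X.
  - move=> c cs; rewrite /update; case: ifPn => [_|ca]; first by exists A.
    by apply: fs; rewrite inE negb_or ca.
transitivity (\int[P]_t ((f a (X a t))%:E * (w t)%:E))%E.
  by apply: eq_integral => t _; rewrite (bigD1 a).
rewrite -(@ge0_integral_weighted_image _ _ _ _ _ P nu (X a) w _ _ _ _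
  (EFin \o f a))//; last 2 first.
- exact/measurable_EFinP.
- by move=> y; rewrite lee_fin.
rewrite ge0_integral_mscale//; last 2 first.
- exact/measurable_EFinP.
- by move=> y _; rewrite lee_fin.
rewrite ge0_integral_distribution//; last 2 first.
- exact/measurable_EFinP.
- by move=> y; rewrite lee_fin.
rewrite (bigD1 a)//= mulrC EFinM; congr (_ * _)%E.
by rewrite /Rintegral fineK//; exact: integrable_fin_num (fi a).
Qed.

Lemma integrable_prod_independent (f : I -> R -> R) :
  (forall c, measurable_fun setT (f c)) ->
  (forall c, P.-integrable setT (EFin \o (fun t => f c (X c t)))) ->
  P.-integrable setT (EFin \o (fun t => \prod_c f c (X c t))) /\
  \int[P]_t (\prod_c f c (X c t)) = \prod_c \int[P]_t f c (X c t).
Proof.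
(* Multilinearity: split one signed factor at a time into f^+ - f^-. *)
suff gen (s : seq I) : (forall c, measurable_fun setT (f c)) ->
    (forall c, P.-integrable setT (EFin \o (fun t => f c (X c t)))) ->
    (forall c, c \notin s -> forall x, 0 <= f c x) ->
    P.-integrable setT (EFin \o (fun t => \prod_c f c (X c t))) /\
    \int[P]_t (\prod_c f c (X c t)) = \prod_c \int[P]_t f c (X c t).
  by move=> mf fi; apply: (gen (enum I)) => // c; rewrite mem_enum.
elim: s f => [|a s IH] f mf fi f0.
  have E := ge0_integral_prod_independent f mf (fun c => f0 c isT) fi.
  split; last by rewrite /Rintegral E.
  apply/integrableP; split.
    apply/measurable_EFinP; apply: measurable_prod => c _.
    exact: measurable_comp_X.
  under eq_integral => t _.
    rewrite /= ger0_norm; last by apply: prodr_ge0 => c _; exact: f0.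
    over.
  by rewrite E ltry.
have [|||ip Ep] := IH (update f a (f a)^\+).
- by move=> c; rewrite /update; case: ifP => // _; exact: measurable_funrpos.
- move=> c; rewrite /update; case: eqP => // -> .
  exact: (integrable_funrpos measurableT (fi a)).
- move=> c cs x; rewrite /update; case: ifPn => [_|ca]; first exact: funrpos_ge0.
  by apply: f0; rewrite inE negb_or ca.
have [|||im Em] := IH (update f a (f a)^\-).
- by move=> c; rewrite /update; case: ifP => // _; exact: measurable_funrneg.
- move=> c; rewrite /update; case: eqP => // -> .
  exact: (integrable_funrneg measurableT (fi a)).
- move=> c cs x; rewrite /update; case: ifPn => [_|ca]; first exact: funrneg_ge0.
  by apply: f0; rewrite inE negb_or ca.
have E t : \prod_c f c (X c t) =
    \prod_c update f a (f a)^\+ c (X c t) - \prod_c update f a (f a)^\- c (X c t).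
  rewrite !(prod_update f a _ (fun c g => g (X c t))) -mulrBl (bigD1 a)//=.
  by congr (_ * _); rewrite -[in LHS](funrposBneg (f a)).
split.
  under eq_fun do rewrite E.
  by apply: eq_integrable (integrableB measurableT ip im).
under eq_Rintegral do rewrite E.
rewrite RintegralB// Ep Em !(prod_update f a _ (fun c g => \int[P]_t g (X c t))).
rewrite -mulrBl -RintegralB//; last 2 first.
- exact: (integrable_funrpos measurableT (fi a)).
- exact: (integrable_funrneg measurableT (fi a)).
rewrite [RHS](bigD1 a)//=; congr (_ * _).
by apply: eq_Rintegral => t _; rewrite -[in RHS](funrposBneg (f a)).
Qed.

End independent_products.

(** * Second moments of sums of products with a centred factor *)

Section orthogonal_sums.
Context {d} {T : measurableType d} {R : realType} (P : probability T R).
Local Notation N := (normal_prob (0 : R) 1).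

Lemma integrable_EFin_sum (I : Type) (s : seq I) (F : I -> T -> R) :
  (forall i, P.-integrable setT (EFin \o F i)) ->
  P.-integrable setT (EFin \o (fun t => \sum_(i <- s) F i t)).
Proof.
move=> Fi; elim: s => [|i s IH].
  by under eq_fun do rewrite big_nil; exact: finite_measure_integrable_cst.
by under eq_fun do rewrite big_cons; exact: integrable_EFinD.
Qed.

Lemma Rintegral_sum (I : Type) (s : seq I) (F : I -> T -> R) :
  (forall i, P.-integrable setT (EFin \o F i)) ->
  \int[P]_t (\sum_(i <- s) F i t) = \sum_(i <- s) \int[P]_t F i t.
Proof.
move=> Fi; elim: s => [|i s IH].
  under eq_Rintegral do rewrite big_nil.
  by rewrite big_nil Rintegral_cst// mul0r.
under eq_Rintegral do rewrite big_cons.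
by rewrite RintegralD// ?IH ?big_cons//; exact: integrable_EFin_sum.
Qed.

Section normal_transfer.
Variable X : T -> R.
Hypothesis mX : measurable_fun setT X.
Hypothesis NX : forall A, measurable A -> P (X @^-1` A) = N A.

Let ge0_integral_normal_transfer (h : R -> \bar R) :
  measurable_fun setT h -> (forall x, 0 <= h x)%E ->
  (\int[P]_t h (X t) = \int[N]_x h x)%E.
Proof.
move=> mh h0.
rewrite (@ge0_integral_weighted_image _ _ _ _ _ P N X (cst 1))//.
  by apply: eq_integral => t _; rewrite mule1.
move=> A mA; rewrite -[LHS]NX//.
under eq_integral do rewrite mulr1.
rewrite -[RHS]/(\int[P]_t (\1_(X @^-1` A) t)%:E)%E integral_indic ?setIT//.
by rewrite -[_ @^-1` _]setTI; exact: mX.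
Qed.

Lemma integrable_normal_transfer (g : R -> R) :
  N.-integrable setT (EFin \o g) ->
  P.-integrable setT (EFin \o (fun t => g (X t))).
Proof.
move=> /integrableP[mg gi]; apply/integrableP; split.
  exact: (measurableT_comp mg mX).
rewrite (ge0_integral_normal_transfer (fun x => `|(g x)%:E|%E))//.
exact: measurableT_comp.
Qed.

Lemma Rintegral_normal_transfer (g : R -> R) :
  N.-integrable setT (EFin \o g) ->
  \int[P]_t g (X t) = \int[N]_x g x.
Proof.
move=> /integrableP[mg gi]; rewrite /Rintegral; congr fine.
rewrite integralE [RHS]integralE.
rewrite -(ge0_integral_normal_transfer (EFin \o g)^\+%E)//; last first.
  exact: measurable_funepos.
rewrite -(ge0_integral_normal_transfer (EFin \o g)^\-%E)//; last first.
  exact: measurable_funeneg.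
by congr (_ - _)%E; apply: eq_integral => t _; rewrite ?funeposE ?funenegE.
Qed.

End normal_transfer.

Variables (C : finType) (n : nat) (X : C * 'I_n -> T -> R).
Hypothesis X_iid : iid_std_normal P X.
Variable phi : C -> R -> R.
Hypothesis phi1 : forall c, N.-integrable setT (EFin \o phi c).
Hypothesis phi2 : forall c,
  N.-integrable setT (EFin \o (fun x => phi c x ^+ 2)).
Variable c0 : C.
Hypothesis phi_c0 : \int[N]_x phi c0 x = 0.

(** Writes the product of the j-th and l-th summands as one product with a single function per noise
    variable, so that independence applies also when j = l, where the exponents become 2. *)
Let F (j l : 'I_n) (i : C * 'I_n) (x : R) :=
  phi i.1 x ^+ ((i.2 == j) + (i.2 == l)).

Let prod_expr_eq (x : 'I_n -> R) j : \prod_k x k ^+ (k == j) = x j.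
Proof.
rewrite (bigD1 j)//= eqxx expr1 big1 ?mulr1// => k /negbTE ->.
by rewrite expr0.
Qed.

Let prod_pairE (h : C * 'I_n -> R) :
  \prod_i h i = \prod_c \prod_k h (c, k).
Proof. by rewrite pair_bigA; apply: eq_bigr => -[]. Qed.

Let prodF j l t : \prod_i F j l i (X i t) =
  (\prod_c phi c (X (c, j) t)) * (\prod_c phi c (X (c, l) t)).
Proof.
rewrite -big_split/=.
rewrite prod_pairE.
apply: eq_bigr => c _; rewrite /F/=.
under eq_bigr do rewrite exprD.
by rewrite big_split/= !prod_expr_eq.
Qed.

Let F_int j l i : N.-integrable setT (EFin \o F j l i).
Proof.
rewrite /F; case: eqP => _; case: eqP => _ /=.
- exact: phi2.
- exact: phi1.
- exact: phi1.
- by under eq_fun do rewrite expr0; exact: finite_measure_integrable_cst.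
Qed.

Let F_prod_integrable j l :
  P.-integrable setT (EFin \o (fun t => \prod_i F j l i (X i t))) /\
  \int[P]_t (\prod_i F j l i (X i t)) =
  \prod_i \int[N]_x F j l i x.
Proof.
case: X_iid => mX NX indep.
have [|i|iF ->] := integrable_prod_independent P _ X mX indep (F j l).
- by move=> i; have /measurable_int/measurable_EFinP := F_int j l i.
- exact: (integrable_normal_transfer _ (mX i) (NX i) (F j l i)).
split => //; apply: eq_bigr => i _.
exact: (Rintegral_normal_transfer _ (mX i) (NX i)).
Qed.

(** Orthogonality: for j <> l the variable ([c0], j) occurs to the first power only, and its centred
    factor annihilates the product. *)
Let F_moment j l : \int[P]_t (\prod_i F j l i (X i t)) =
  (j == l)%:R * \prod_c \int[N]_x (phi c x ^+ 2).
Proof.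
rewrite (F_prod_integrable j l).2; have [<-|jl] := eqVneq j l; last first.
  rewrite mul0r (bigD1 (c0, j))//= /F/= eqxx (negbTE jl).
  by rewrite phi_c0 mul0r.
rewrite mul1r prod_pairE.
apply: eq_bigr => c _; rewrite (bigD1 j)//= big1 ?mulr1.
  by rewrite /F/= eqxx.
move=> k /negbTE kj; rewrite /F/= kj; exact: Rintegral_normal_cst.
Qed.

Let sqr_sumE t : (\sum_j \prod_c phi c (X (c, j) t)) ^+ 2 =
  \sum_j \sum_l \prod_i F j l i (X i t).
Proof.
rewrite expr2 big_distrlr/=.
by apply: eq_bigr => j _; apply: eq_bigr => l _; rewrite prodF.
Qed.

Lemma integrable_sqr_sum_prod : P.-integrable setT
  (EFin \o (fun t => (\sum_j \prod_c phi c (X (c, j) t)) ^+ 2)).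
Proof.
under eq_fun do rewrite sqr_sumE.
apply: integrable_EFin_sum => j; apply: integrable_EFin_sum => l.
exact: (F_prod_integrable j l).1.
Qed.

(** Once the square is expanded, only the n diagonal terms survive. *)
Lemma Rintegral_sqr_sum_prod :
  \int[P]_t ((\sum_j \prod_c phi c (X (c, j) t)) ^+ 2) =
  n%:R * \prod_c \int[N]_x (phi c x ^+ 2).
Proof.
under eq_Rintegral do rewrite sqr_sumE.
have Fi j l := (F_prod_integrable j l).1.
rewrite Rintegral_sum => [|j]; last exact: integrable_EFin_sum.
transitivity (\sum_(j < n) \prod_c \int[N]_x (phi c x ^+ 2)).
  apply: eq_bigr => j _; rewrite Rintegral_sum => [|l]; last exact: Fi.
  rewrite (eq_bigr _ (fun l _ => F_moment j l)).
  rewrite (bigD1 j)//= eqxx mul1r [X in _ + X]big1 ?addr0// => l.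
  by rewrite eq_sym => /negbTE ->; rewrite mul0r.
by rewrite sumr_const card_ord mulr_natl.
Qed.

End orthogonal_sums.

(** * Polynomial sums in i.i.d. normal variables *)

Section hermite_chaos.
Context {R : realType}.
Local Notation N := (normal_prob (0 : R) 1).

(* Only degrees 0, 1 and 2 are meant; larger degrees are junk. *)
Definition hermite (k : nat) (x : R) : R :=
  match k with 0 => 1 | 1 => x | _ => x ^+ 2 - 1 end.

(* Bounds the second moment; the exact value in degree 2 is 2. *)
Definition hermite_bound (k : nat) : R :=
  match k with 0 => 1 | 1 => 1 | _ => 4 end.

Let iX k : (k <= 4)%N -> N.-integrable setT (EFin \o (fun x => x ^+ k)) :=
  integrable_normal_exprn k.

Let i1 (r : R) : N.-integrable setT (EFin \o (fun=> r)).
Proof. exact: finite_measure_integrable_cst. Qed.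

Lemma integrable_hermite k : N.-integrable setT (EFin \o hermite k).
Proof.
case: k => [|[|k]]; [exact: i1|exact: (iX 1)|].
by apply: (integrable_EFinD _ _ (fun=> - 1)); [exact: iX|exact: i1].
Qed.

Let sqr_hermite2 (x : R) :
  (x ^+ 2 - 1) ^+ 2 = x ^+ 4 + ((- 2) * x ^+ 2 + 1).
Proof. ring. Qed.

Lemma integrable_sqr_hermite k :
  N.-integrable setT (EFin \o (fun x => hermite k x ^+ 2)).
Proof.
case: k => [|[|k]] /=; [exact: i1|exact: iX|].
under eq_fun do rewrite sqr_hermite2.
apply: integrable_EFinD; first exact: iX.
by apply: integrable_EFinD; [apply: integrable_EFinZl; exact: iX|exact: i1].
Qed.

Lemma Rintegral_hermite k : k != 0 -> \int[N]_x hermite k x = 0.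
Proof.
case: k => [|[|k]] //= _; first exact: normal_moment1.
rewrite (@RintegralD _ _ _ _ _ _ (fun=> - 1))//; [|exact: iX].
by rewrite normal_moment2 Rintegral_normal_cst subrr.
Qed.

Lemma Rintegral_sqr_hermite_le k :
  \int[N]_x (hermite k x ^+ 2) <= hermite_bound k.
Proof.
case: k => [|[|k]] /=.
- by under eq_Rintegral do rewrite expr1n; rewrite Rintegral_normal_cst.
- by rewrite normal_moment2.
under eq_Rintegral do rewrite sqr_hermite2.
have i2 := integrable_EFinZl N (- 2) _ (iX 2 isT).
rewrite RintegralD ?RintegralD ?RintegralZl//; [|exact: iX|exact: iX|].
  (* The fourth moment bound 5 gives 5 - 2 + 1 = 4, the value of [hermite_bound] in degree 2. *)
  rewrite normal_moment2 Rintegral_normal_cst.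
  have := @normal_moment4_le R; lra.
by apply: integrable_EFinD.
Qed.

Context {d} {T : measurableType d} (P : probability T R).
Variables (C : finType) (n : nat) (X : C * 'I_n -> T -> R).
Hypothesis X_iid : iid_std_normal P X.

(** For degrees at most 2 and i.i.d. standard normal [X], an element of the Wiener chaos of order
    [\sum_c m c]. *)
Definition chaos (m : C -> nat) (t : T) : R :=
  \sum_j \prod_c hermite (m c) (X (c, j) t).

Variables (m : C -> nat) (c0 : C).
Hypothesis mc0 : m c0 != 0.

Lemma integrable_sqr_chaos :
  P.-integrable setT (EFin \o (fun t => chaos m t ^+ 2)).
Proof.
apply: (integrable_sqr_sum_prod P C n X X_iid (fun c => hermite (m c))).
- by move=> c; exact: integrable_hermite.
- by move=> c; exact: integrable_sqr_hermite.
Qed.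

(** The nonzero degree at [c0] provides the centred factor that makes distinct coordinates
    orthogonal. *)
Lemma Rintegral_sqr_chaos_le :
  \int[P]_t (chaos m t ^+ 2) <= n%:R * \prod_c hermite_bound (m c).
Proof.
rewrite (Rintegral_sqr_sum_prod P C n X X_iid (fun c => hermite (m c)) _ _ c0).
- apply: ler_wpM2l => //; apply: ler_prod => c _.
  rewrite Rintegral_sqr_hermite_le andbT.
  by apply: Rintegral_ge0 => x _; exact: sqr_ge0.
- by move=> c; exact: integrable_hermite.
- by move=> c; exact: integrable_sqr_hermite.
- exact: Rintegral_hermite.
Qed.

End hermite_chaos.

(** * Numerical inequalities and a Markov bound *)

(** From ln x >= 1 - 1/x on the factors of 6 = 2 * 2 * (3/2): 1/2 + 1/2 + 1/3 = 4/3. *)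
Lemma ln6_ge (R : realType) : 4 / 3 <= ln 6 :> R.
Proof.
have ln_ge (x : R) : 0 < x -> 1 - x^-1 <= ln x.
  move=> x0; have /le_ln1Dx : -1 < x^-1 - 1.
    by have := x0; rewrite -invr_gt0; lra.
  by rewrite addrC subrK lnV ?posrE//; lra.
have -> : (6 : R) = 2 * 2 * (3 / 2) by field.
rewrite lnM ?posrE ?mulr_gt0// lnM ?posrE//.
have /ln_ge : (0 : R) < 2 by [].
have /ln_ge : (0 : R) < 3 / 2 by rewrite divr_gt0.
rewrite invf_div; lra.
Qed.

(** Cauchy-Schwarz against the all-ones vector. Applied pointwise to the six fluctuation terms, it
    avoids computing their mixed moments, at the cost of a factor 6. *)
Lemma sqr_sum6_le (R : realDomainType) (x y z u v w : R) :
  (x + y + z + u + v + w) ^+ 2 <=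
  6 * (x ^+ 2 + y ^+ 2 + z ^+ 2 + u ^+ 2 + v ^+ 2 + w ^+ 2).
Proof.
have sqr3 (p q r : R) : (p + q + r) ^+ 2 <= 3 * (p ^+ 2 + q ^+ 2 + r ^+ 2).
  have := sqr_ge0 (p - q); have := sqr_ge0 (p - r); have := sqr_ge0 (q - r).
  nra.
have := sqr3 x y z; have := sqr3 u v w.
have := sqr_ge0 (x + y + z - (u + v + w)).
nra.
Qed.

(** Markov's inequality for [Q] at level [t] bounds the probability of the complement by 1/2. With
    [Q] above the square of the fluctuation this is Chebyshev's inequality. *)
Lemma half_le_probability {d} {T : measurableType d} {R : realType}
    (P : probability T R) (E : set T) (Q : T -> R) (t : R) :
  measurable E -> P.-integrable setT (EFin \o Q) -> (forall w, 0 <= Q w) ->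
  0 < t -> ~` E `<=` [set w | t <= Q w] -> \int[P]_w Q w <= t / 2 ->
  ((1 / 2)%:E <= P E)%E.
Proof.
move=> mE Qi Q0 t0 EQ Qt.
have mQ := measurable_int _ Qi.
have := le_integral_abse P measurableT mQ t0.
rewrite setTI => markov.
have PEc : (t%:E * P (~` E) <= (t / 2)%:E)%E.
  apply: le_trans (le_trans markov _).
    rewrite lee_pmul2l// ?lte_fin//; apply: le_measure; rewrite ?inE.
    - exact: measurableC.
    - rewrite -[X in measurable X]setTI.
      by apply: emeasurable_fun_c_infty => //; exact: measurableT_comp.
    - by move=> w /EQ/=; rewrite lee_fin ger0_norm.
  under eq_integral do rewrite /= ger0_norm//.
  by rewrite -[X in (X <= _)%E]fineK ?lee_fin//; exact: integrable_fin_num.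
rewrite -[E]setCK probability_setC; last exact: measurableC.
have PEfin : P (~` E) \is a fin_num.
  by apply: fin_num_measure; exact: measurableC.
move: PEc; rewrite -(fineK PEfin) -EFinM -EFinB !lee_fin => h.
have : fine (P (~` E)) <= 1 / 2 by rewrite -(ler_pM2l t0); lra.
lra.
Qed.

Lemma measurable_chaos {R : realType} {d} {T : measurableType d}
    (C : finType) (n : nat) (X : C * 'I_n -> T -> R) (m : C -> nat) :
  (forall i, measurable_fun setT (X i)) -> measurable_fun setT (chaos C n X m).
Proof.
move=> mX; apply: measurable_sum => j; apply: measurable_prod => c _.
apply: (measurableT_comp _ (mX (c, j))).
by have /measurable_int/measurable_EFinP := @integrable_hermite R (m c).
Qed.

(** * The two-point configuration *)

Lemma ord2P (i : 'I_2) : i = ord0 \/ i = ord_max.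
Proof. by case: i => -[|[|//]] i2; [left|right]; exact: val_inj. Qed.

Lemma prod_bool_I2 (R : comRingType) (G : bool * 'I_2 -> R) :
  \prod_c G c = G (false, ord0) * G (true, ord0) * G (false, ord_max)
                * G (true, ord_max).
Proof.
transitivity (\prod_b \prod_i G (b, i)).
  by rewrite pair_bigA; apply: eq_bigr => -[].
rewrite big_bool !big_ord_recl !big_ord0 !mulr1/=.
have -> : lift ord0 ord0 = ord_max :> 'I_2 by exact: val_inj.
ring.
Qed.

Lemma le_kappa_bar {R : realType} (n d : nat) (theta : 'I_n -> 'rV[R]_d)
    (sigma : 'I_n -> R) (k : R) :
  (forall i j, i != j ->
    k <= enorm (theta i - theta j) / Num.sqrt (sigma i ^+ 2 + sigma j ^+ 2)) ->
  (k%:E <= kappa_bar theta sigma)%E.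
Proof.
move=> h; rewrite /kappa_bar.
elim/big_ind: _ => [|x y kx ky|[i j]/= ij]; first exact: leey.
- by rewrite le_min kx.
- by rewrite lee_fin h.
Qed.

Lemma enorm_const_mx {R : realType} (d : nat) (a : R) :
  enorm (const_mx a : 'rV_d) = `|a| * Num.sqrt d%:R.
Proof.
rewrite /enorm; under eq_bigr do rewrite mxE.
by rewrite sumr_const card_ord -[a ^+ 2 *+ d]mulr_natr sqrtrM ?sqr_ge0// sqrtr_sqr.
Qed.

(** Only the first choice can go wrong, since the second has one candidate left. The inequality is
    strict because a tie still admits the identity. *)
Lemma greedy_error_two {R : realType} (d : nat) (T : Type)
    (theta : 'I_2 -> 'rV[R]_d) (sigma : 'I_2 -> R)
    (xi : bool * 'I_2 * 'I_d -> T -> R) :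
  greedy_error theta sigma 1%g xi =
  [set w | let X := obsX theta sigma xi w in
           let Y := obsXs theta sigma 1%g xi w ord0 in
           \sum_k (X ord_max - Y) 0 k ^+ 2 < \sum_k (X ord0 - Y) 0 k ^+ 2].
Proof.
have enorm_le (u v : 'rV[R]_d) : (enorm u <= enorm v) =
    (\sum_k u 0 k ^+ 2 <= \sum_k v 0 k ^+ 2).
  by rewrite /enorm ler_sqrt// sumr_ge0// => k _; exact: sqr_ge0.
apply/seteqP; split=> w /=.
  rewrite ltNge => greedyN; apply/negP => le01; apply: greedyN => i j.
  case: (ord2P i) => ->; case: (ord2P j) => ->; rewrite !perm1//.
  - by rewrite enorm_le.
  - by move=> /(_ ord0 isT); rewrite perm1 eqxx.
rewrite ltNge => /negP lt01 greedy; apply: lt01.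
by have := greedy ord0 ord_max; rewrite perm1 enorm_le; apply.
Qed.

Section two_points.
Context {R : realType} {d : nat} {dT : measure_display} {T : measurableType dT}.
Variables (P : probability T R) (xi : bool * 'I_2 * 'I_d -> T -> R).
Variables (sigma : 'I_2 -> R) (delta : R).
Hypothesis sigma0 : sigma ord0 ^+ 2 = 3.
Hypothesis sigma1 : sigma ord_max = 1.
Hypothesis delta2 : delta ^+ 2 = 2 / 25.
Hypothesis xi_iid : iid_std_normal P xi.

Definition two_points (i : 'I_2) : 'rV[R]_d :=
  if i == ord0 then 0 else const_mx delta.

(* Degrees in xi_1, xi_1^# and xi_2; xi_2^# plays no role. *)
Let index (i j l : nat) (c : bool * 'I_2) : nat :=
  if c.1 then if c.2 == ord0 then j else 0%N
  else if c.2 == ord0 then i else l.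

Let H (i j l : nat) : T -> R := chaos _ d xi (index i j l).

Let HE i j l t : H i j l t = \sum_k (hermite i (xi (false, ord0, k) t) *
  hermite j (xi (true, ord0, k) t) * hermite l (xi (false, ord_max, k) t)).
Proof. by apply: eq_bigr => k _; rewrite prod_bool_I2/= mulr1. Qed.

(** In each coordinate this expands s^2 (a - b)^2 - (delta + c - s b)^2, where a, b, c are the
    coordinates of xi_1, xi_1^# and xi_2. The terms s^2 b^2 cancel, and centring a^2 and c^2 leaves
    the constant 3 - 1 - delta^2 = 48/25. *)
Lemma sqr_dist_diffE w (X := obsX two_points sigma xi w)
    (Y := obsXs two_points sigma 1%g xi w ord0) :
  \sum_k (X ord0 - Y) 0 k ^+ 2 - \sum_k (X ord_max - Y) 0 k ^+ 2 =
  48 / 25 * d%:R + (3 * H 2 0 0 w + (- 1) * H 0 0 2 w + (- 2 * delta) * H 0 0 1 w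
    + (- 6) * H 1 1 0 w + 2 * sigma ord0 * H 0 1 1 w
    + 2 * sigma ord0 * delta * H 0 1 0 w).
Proof.
have -> : 48 / 25 * d%:R = \sum_(k < d) (48 / 25 : R).
  by rewrite sumr_const card_ord mulr_natr.
rewrite !HE !mulr_sumr -sumrN -!big_split/= ; apply: eq_bigr => k _.
rewrite /X /Y /obsX /obsXs /two_points /noise_vec perm1 !mxE/= sigma1.
set a := xi (false, _, _) w; set b := xi (true, _, _) w.
set c := xi (false, _, _) w; set s := sigma ord0.
(* The last summand vanishes when s^2 = 3 and delta^2 = 2/25; adding it gives an identity valid for
   all s and delta, which [field] can check. *)
transitivity (48 / 25 + (3 * ((a ^+ 2 - 1) * 1 * 1) + (- 1) * (1 * 1 * (c ^+ 2 - 1))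
  + (- 2 * delta) * (1 * 1 * c) + (- 6) * (a * b * 1)
  + 2 * s * (1 * b * c) + 2 * s * delta * (1 * b * 1))
  + ((s ^+ 2 - 3) * (a ^+ 2 - 2 * a * b) - (delta ^+ 2 - 2 / 25))).
  by field.
by rewrite sigma0 delta2 !subrr mul0r subrr addr0.
Qed.

(** The bound of [sqr_sum6_le] for the fluctuation: the squared coefficients of [sqr_dist_diffE],
    evaluated at sigma_1^2 = 3 and delta^2 = 2/25. *)
Let Q t := 6 * (9 * H 2 0 0 t ^+ 2 + H 0 0 2 t ^+ 2 + 8 / 25 * H 0 0 1 t ^+ 2
  + 36 * H 1 1 0 t ^+ 2 + 12 * H 0 1 1 t ^+ 2 + 24 / 25 * H 0 1 0 t ^+ 2).

Let weights : seq (R * (bool * 'I_2 -> nat)) :=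
  [:: (54, index 2 0 0); (6, index 0 0 2); (48 / 25, index 0 0 1);
      (216, index 1 1 0); (72, index 0 1 1); (144 / 25, index 0 1 0)].

Let QE t : Q t =
  \sum_(p <- weights) p.1 * chaos _ d xi p.2 t ^+ 2.
Proof. by rewrite !big_cons big_nil /Q/= /H; field. Qed.

Let summand_integrable (p : R * (bool * 'I_2 -> nat)) : P.-integrable setT
  (EFin \o (fun t => p.1 * chaos _ d xi p.2 t ^+ 2)).
Proof. by apply: integrable_EFinZl; exact: integrable_sqr_chaos. Qed.

Let Q_integrable : P.-integrable setT (EFin \o Q).
Proof. by rewrite (funext QE); exact: integrable_EFin_sum. Qed.

(** A degree 2 contributes a factor 4 and lower degrees a factor 1, so the constant is 54 * 4 + 6 *
    4 + 48/25 + 216 + 72 + 144/25. *)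
Let Rintegral_Q_le : \int[P]_t Q t <= 13392 / 25 * d%:R.
Proof.
under eq_Rintegral do rewrite QE.
rewrite Rintegral_sum//.
have chaos_le (w : R) (m : bool * 'I_2 -> nat) c0 : m c0 != 0%N -> 0 <= w ->
    \int[P]_t (w * chaos _ d xi m t ^+ 2) <=
    w * (d%:R * \prod_c hermite_bound (m c)).
  move=> mc0 w0; rewrite RintegralZl//; last exact: integrable_sqr_chaos.
  by apply: ler_wpM2l => //; exact: (Rintegral_sqr_chaos_le P _ _ xi xi_iid m c0).
rewrite !big_cons big_nil/=.
have h1 := chaos_le 54 (index 2 0 0) (false, ord0) isT (ler0n _ _).
have h2 := chaos_le 6 (index 0 0 2) (false, ord_max) isT (ler0n _ _).
have h3 := chaos_le (48 / 25) (index 0 0 1) (false, ord_max) isT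
  (divr_ge0 (ler0n _ _) (ler0n _ _)).
have h4 := chaos_le 216 (index 1 1 0) (false, ord0) isT (ler0n _ _).
have h5 := chaos_le 72 (index 0 1 1) (true, ord0) isT (ler0n _ _).
have h6 := chaos_le (144 / 25) (index 0 1 0) (true, ord0) isT
  (divr_ge0 (ler0n _ _) (ler0n _ _)).
rewrite addr0; apply: le_trans
  (lerD h1 (lerD h2 (lerD h3 (lerD h4 (lerD h5 h6))))) _.
rewrite !prod_bool_I2/=; move: d%:R => x.
by rewrite le_eqVlt; apply/orP; left; apply/eqP; field.
Qed.

Lemma half_le_greedy_error : 300 <= d%:R :> R ->
  ((1 / 2)%:E <= P (greedy_error two_points sigma 1%g xi))%E.
Proof.
move=> d300; have d0 : 0 < d%:R :> R by exact: lt_le_trans d300.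
pose Z t := 3 * H 2 0 0 t + (- 1) * H 0 0 2 t + (- 2 * delta) * H 0 0 1 t
    + (- 6) * H 1 1 0 t + 2 * sigma ord0 * H 0 1 1 t
    + 2 * sigma ord0 * delta * H 0 1 0 t.
have errorE : greedy_error two_points sigma 1%g xi =
    [set w | 0 < 48 / 25 * d%:R + Z w].
  rewrite greedy_error_two; apply/funext => w; rewrite -[RHS]/(is_true _).
  by rewrite -sqr_dist_diffE subr_gt0.
have mH i j l : measurable_fun setT (H i j l).
  by apply: measurable_chaos; case: xi_iid.
have mZ : measurable_fun setT (fun w => 48 / 25 * d%:R + Z w).
  by repeat (apply: measurable_funD => //); apply: measurable_funM => //.
have ZQ w : Z w ^+ 2 <= Q w.
  apply: le_trans (sqr_sum6_le _ _ _ _ _ _ _) _.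
  rewrite /Q !exprMn sigma0 delta2; lra.
(* The level is the squared mean: without an error, [Z] is at most minus the mean, so its square
   reaches this level. *)
apply: (half_le_probability P _ Q ((48 / 25 * d%:R) ^+ 2)) => //.
- rewrite errorE.
  have -> : [set w | 0 < 48 / 25 * d%:R + Z w] =
      setT `&` [set w | (0%:E < (48 / 25 * d%:R + Z w)%:E)%E].
    by rewrite setTI; apply/seteqP; split=> w /=; rewrite lte_fin.
  by apply: emeasurable_fun_o_infty => //; exact/measurable_EFinP.
- by move=> w; apply: le_trans (ZQ w); exact: sqr_ge0.
- by rewrite exprn_gt0// mulr_gt0.
- move=> w; rewrite errorE/= => /negP; rewrite -leNgt => ZN.
  by apply: le_trans (ZQ w); nra.
(* The comparison 13392/25 d <= (48/25 d)^2 / 2 holds for d >= 290.625. *)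
- by apply: le_trans Rintegral_Q_le _; nra.
Qed.

End two_points.

Theorem theorem5 (R : realType) (d : nat) (dT : measure_display)
  (T : measurableType dT) (P : probability T R)
  (xi : bool * 'I_2 * 'I_d -> T -> R) (sigma : 'I_2 -> R) (kappa : R) :
  (1 <= d)%N ->
  225 * ln 6 <= (d%:R : R) ->
  (forall i, 0 < sigma i) ->
  sigma ord0 ^+ 2 = 3 ->
  sigma ord_max ^+ 2 = 1 ->
  iid_std_normal P xi ->
  kappa < Num.sqrt (2 * d%:R) / 10 ->
  ((1 / 2)%:E <=
    ereal_sup [set P (greedy_error theta sigma (1%g : {perm 'I_2}) xi)
                | theta in [set theta : 'I_2 -> 'rV[R]_d |
                              (kappa%:E <= kappa_bar theta sigma)%E]])%E.
Proof.
move=> _ hd sigma_gt0 sigma0 sigma1 xi_iid hkappa.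
have d300 : 300 <= d%:R :> R by have := @ln6_ge R; lra.
(* The two centres are at distance delta sqrt(d), and sqrt(3 + 1) = 2, so this delta gives relative
   separation exactly sqrt(2 d) / 10, which exceeds [kappa]. *)
pose delta : R := Num.sqrt 2 / 5.
have delta0 : 0 <= delta by rewrite divr_ge0 ?sqrtr_ge0.
have delta2 : delta ^+ 2 = 2 / 25.
  by rewrite exprMn sqr_sqrtr//; field.
have sigma1E : sigma ord_max = 1.
  by apply/eqP; rewrite -(@eqrXn2 _ 2) ?ler01 ?expr1n ?sigma1// ltW.
apply: (le_trans (half_le_greedy_error P xi sigma delta _ _ _ _ _)) => //.
apply: ereal_sup_ubound; exists (two_points delta) => //=.
apply: le_kappa_bar => i j ij.
have [-> ->] : enorm (two_points delta i - two_points delta j : 'rV[R]_d) =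
      delta * Num.sqrt d%:R /\ sigma i ^+ 2 + sigma j ^+ 2 = 2 ^+ 2.
  have d0 : enorm (const_mx delta : 'rV_d) = delta * Num.sqrt d%:R.
    by rewrite enorm_const_mx ger0_norm.
  have dN : enorm (- const_mx delta : 'rV_d) = delta * Num.sqrt d%:R.
    by rewrite -d0 /enorm; under eq_bigr do rewrite mxE sqrrN.
  move: ij; case: (ord2P i) => ->; case: (ord2P j) => -> //= _;
    rewrite /two_points/= ?sub0r ?subr0 sigma0 sigma1; split => //; ring.
apply: ltW; apply: lt_le_trans hkappa _.
rewrite sqrtr_sqr ger0_norm// /delta sqrtrM//.
by rewrite le_eqVlt; apply/orP; left; apply/eqP; field.
Qed.
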